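(* Let $(T_n)_{n\ge -3}$ be the Padovan sequence. For all integers $m\ge 0$ and $n\ge 0$, $$T_{m+n}=T_{m-1}T_n+T_mT_{n-1}+(T_{m+1}-T_{m-1})T_{n-2}.$$
   Context: The Padovan sequence is the integer sequence defined by $T_0=0$, $T_1=1$, $T_2=1$ and $T_{n+3}=T_{n+1}+T_n$ for all $n\ge 0$, extended to negative indices by $T_{-1}=1$, $T_{-2}=0$, $T_{-3}=0$ (so that the recurrence holds for all $n\ge -3$). *)

(* Defs.v *)
From mathcomp Require Import all_boot all_order all_algebra.

Set Implicit Arguments.
Unset Strict Implicit.
Unset Printing Implicit Defensive.

Import Order.TTheory GRing.Theory Num.Theory.
Local Open Scope ring_scope.

Fixpoint padovan_nat (n : nat) : int :=
  match n with
  | 0%N => 0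
  | 1%N => 1
  | 2%N => 1
  | (k.+1 as k1).+2 => padovan_nat k1 + padovan_nat k
  end.

(* [Negz k] is the integer -(k + 1), so the last two cases give T_(-1) = 1
   and T_(-2) = T_(-3) = 0; the value 0 below -3 is a dummy. *)
Definition padovan (i : int) : int :=
  match i with
  | Posz n => padovan_nat n
  | Negz 0%N => 1
  | Negz _ => 0
  end.

Lemma padovan_rec (n : int) :
  -3 <= n -> padovan (n + 3) = padovan (n + 1) + padovan n.
Proof.
case: n => [n _|[|[|[|n]]] //].
by rewrite -!PoszD addn3 addn1.
Qed.

(* Main.v *)
Require Import Defs.
From mathcomp Require Import all_boot all_order all_algebra.
From mathcomp Require Import ring zify.

Import Order.TTheory GRing.Theory Num.Theory.
Local Open Scope ring_scope.

(** For fixed n the right side is linear in T_{m-1}, T_m, T_{m+1}, with coefficients free of m, so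
    it inherits the recurrence in m. *)

(** Indices enter through equations, so [lia] can match them in any form. *)
Lemma padovan_shift (a b c : int) :
  -3 <= a -> b = a + 1 -> c = a + 3 -> padovan c = padovan b + padovan a.
Proof. by move=> ha -> ->; apply: padovan_rec. Qed.

(* In [m], both sides satisfy the Padovan recurrence, so it suffices to check
   m = 0, 1, 2. *)
Theorem mainTheorem2 (m n : int) (hm : 0 <= m) (hn : 0 <= n) :
  padovan (m + n) =
    padovan (m - 1) * padovan n + padovan m * padovan (n - 1)
      + (padovan (m + 1) - padovan (m - 1)) * padovan (n - 2).
Proof.
case: m hm => // m _.
elim/ltn_ind: m => -[|[|[|m]]] IH.
- by rewrite add0r /=; ring.
(* At m = 1 the right side is T_{n-1} + T_{n-2}. *)
- rewrite (padovan_shift (n - 2) (n - 1)); [| lia..].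
  by rewrite /=; ring.
- rewrite (padovan_shift (n - 1) n); [| lia..].
  by rewrite /=; ring.
(* Every term in m + 3 splits into its analogues at m + 1 and m, where [IH] applies. *)
rewrite (padovan_shift (m%:Z + n) (m.+1%:Z + n)); [| lia..].
rewrite (padovan_shift (m%:Z - 1) (m.+1%:Z - 1) (m.+3%:Z - 1)); [| lia..].
rewrite (padovan_shift m m.+1 m.+3); [| lia..].
rewrite (padovan_shift (m%:Z + 1) (m.+1%:Z + 1) (m.+3%:Z + 1)); [| lia..].
rewrite !IH; [| lia..].
ring.
Qed.
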